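(* There is a family of pairs $(\widehat J_{q,N},\widehat A_{q,N})$, indexed by integers $q\ge1$ and $N\ge2q+1$, where $\widehat J_{q,N}\in\mathbb{C}^{N\times N}$ is a fundamental symmetry with negative index $q$ and $\widehat A_{q,N}\in\mathbb{C}^{N\times N}$ is $\widehat J_{q,N}$-selfadjoint, such that for all such $q,N$ $$\sigma(\widehat A_{q,N})\subset\{z\in\mathbb{C}:|z|<1\},\qquad d(\widehat A_{q,N})=N,\qquad \nu_{\widehat J_{q,N}}(\widehat A_{q,N})=2q+1,$$ and, for every sequence of integers $N(q)\ge2q+1$, $$\frac{\mathcal{M}(\widehat A_{q,N(q)})}{e\,(2q+1)\,\mathcal{K}(\widehat A_{q,N(q)})}\longrightarrow1\qquad(q\to\infty).$$ In particular, $N(q)$ may be chosen so that $q/N(q)\to0$.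
   Context: A fundamental symmetry is a complex square matrix $J$ with $J=J^*=J^{-1}$; its negative index is the number of its eigenvalues equal to $-1$, counted with multiplicity. A matrix $A$ is $J$-selfadjoint if $A^*J=JA$. $\sigma(A)$ is the spectrum of $A$, and $d(A)$ is the degree of the minimal polynomial of $A$. For $J\in\mathbb{C}^{N\times N}$ a fundamental symmetry with negative index $q$ and $A\in\mathbb{C}^{N\times N}$, set $\nu_J(A):=\min\{d(A),\,2q+1,\,2(N-q)+1\}$. $\|\cdot\|_2$ is the spectral norm. For $A$ with spectrum in the closed unit disk, $\mathcal{M}(A):=\sup_{k\ge0}\|A^k\|_2$ and $\mathcal{K}(A):=\sup_{|z|>1}(|z|-1)\|(zI-A)^{-1}\|_2$. *)

(* Defs.v *)
From HB Require Import structures.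
From mathcomp Require Import all_boot all_order all_algebra.
From mathcomp Require Import complex.
From mathcomp Require Import all_classical all_reals all_analysis.

Set Implicit Arguments.
Unset Strict Implicit.
Unset Printing Implicit Defensive.

Import Order.TTheory GRing.Theory Num.Theory.
Import numFieldNormedType.Exports.

Local Open Scope classical_set_scope.
Local Open Scope ring_scope.
Local Open Scope complex_scope.

Definition adjmx (R : realType) (m n : nat) (A : 'M[R[i]]_(m, n)) :
  'M[R[i]]_(n, m) := map_mx Num.conj A^T.

(* [invmx] returns its argument on singular matrices, hence the explicit
   invertibility condition *)
Definition fundamental_symmetry (R : realType) (N : nat) (J : 'M[R[i]]_N) :
  Prop := [/\ J \in unitmx, J = adjmx J & J = invmx J].

Definition neg_index (R : realType) (N : nat) (J : 'M[R[i]]_N) : nat :=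
  mup (-1) (char_poly J).

Definition J_selfadjoint (R : realType) (N : nat) (J A : 'M[R[i]]_N) : Prop :=
  adjmx A *m J = J *m A.

Definition spectrum (R : realType) (N : nat) (A : 'M[R[i]]_N) : set R[i] :=
  [set z | eigenvalue A z].

(* [mxminpoly] is only available for nonzero size; the minimal polynomial of
   the 0 x 0 matrix is 1, of degree 0 *)
Definition minpoly_degree (R : realType) (N : nat) : 'M[R[i]]_N -> nat :=
  match N return 'M[R[i]]_N -> nat with
  | 0 => fun=> 0%N
  | n.+1 => fun A => (size (mxminpoly A)).-1
  end.

Definition nu (R : realType) (N : nat) (J A : 'M[R[i]]_N) : nat :=
  let q := neg_index J in
  minn (minpoly_degree A) (minn (2 * q + 1) (2 * (N - q) + 1)).

Definition vnorm2 (R : realType) (N : nat) (x : 'cV[R[i]]_N) : R :=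
  Num.sqrt (\sum_i Normc.normc (x i 0) ^+ 2).

(* the operator norm induced by the Euclidean norm, i.e. the spectral norm *)
Definition specnorm (R : realType) (N : nat) (A : 'M[R[i]]_N) : R :=
  sup [set vnorm2 (A *m x) | x in [set x | vnorm2 x = 1]].

Definition power_bound (R : realType) (N : nat) (A : 'M[R[i]]_N) : \bar R :=
  ereal_sup (range (fun k : nat => (specnorm (A ^+ k))%:E)).

Definition kreiss_constant (R : realType) (N : nat) (A : 'M[R[i]]_N) :
  \bar R :=
  ereal_sup [set ((Normc.normc z - 1) * specnorm (invmx (z%:M - A)))%:E
            | z in [set z : R[i] | 1 < Normc.normc z]].

(* Main.v *)
(* The witness is A = g S (+) diag(lambda_i), where S is the lower shift of size n = 2q+1, the
   lambda_i are distinct in (0, 1), and J is the flip of the first n coordinates.  Since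
   ||A^k|| and the resolvent are dominated by the corner entry of the shift block when g is
   large, M(A) ~ g^(n-1) and K(A) ~ g^(n-1) max_(t > 1) (t-1)/t^n, and that maximum equals
   (n-1)^(n-1)/n^n ~ 1/(e n).  Taking g = N^4 makes every other entry negligible even after
   summing all N^2 of them, so the crude bound of the spectral norm by the sum of the moduli
   of the entries suffices, with an error uniform in N. *)
Require Import Defs.
From mathcomp Require Import all_boot all_order all_algebra.
From mathcomp Require Import complex.
From mathcomp Require Import zify lra ring.
From mathcomp Require Import all_classical all_reals all_analysis.
Import Order.TTheory GRing.Theory Num.Theory.
Import numFieldNormedType.Exports.
Local Open Scope classical_set_scope.
Local Open Scope ring_scope.
Local Open Scope complex_scope.

Set Implicit Arguments.
Unset Strict Implicit.
Unset Printing Implicit Defensive.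

Local Notation normc := Normc.normc.
Local Arguments Normc.normc R x : simpl never.

(** * Entrywise bounds for the spectral norm *)

Section Norms.
Variable R : realType.
Implicit Types (N : nat) (z : R[i]).

Lemma normcE z : (normc z)%:C = `|z|.
Proof. by case: z. Qed.

Lemma normc_ge0 z : 0 <= normc z.
Proof. by rewrite -lecR normcE normr_ge0. Qed.

Lemma normc_le_add z z' : normc (z + z') <= normc z + normc z'.
Proof. by rewrite -lecR rmorphD /= !normcE ler_normD. Qed.

Lemma normc_real (x : R) : 0 <= x -> normc x%:C = x.
Proof. by move=> x0; apply: complexI; rewrite normcE ger0_norm // lecR. Qed.

Lemma normc_nat n : normc n%:R = n%:R :> R.
Proof. by rewrite -(rmorph_nat (real_complex R)) normc_real. Qed.

Lemma normcX z k : normc (z ^+ k) = normc z ^+ k.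
Proof. by apply: complexI; rewrite rmorphXn /= !normcE normrX. Qed.

Lemma normc_sum (I : finType) (F : I -> R[i]) :
  normc (\sum_i F i) <= \sum_i normc (F i).
Proof.
elim/big_ind2: _ => [|x a y b xa yb|//]; first by rewrite Normc.normc0.
exact: (le_trans (normc_le_add _ _) (lerD xa yb)).
Qed.

Lemma normc_le_vnorm2 N (x : 'cV[R[i]]_N) j : normc (x j 0) <= vnorm2 x.
Proof.
rewrite -[leLHS]ger0_norm ?normc_ge0// -sqrtr_sqr ler_wsqrtr//.
by rewrite (bigD1 j) //= lerDl sumr_ge0 // => i _; rewrite sqr_ge0.
Qed.

Lemma vnorm2_le_sum N (x : 'cV[R[i]]_N) : vnorm2 x <= \sum_i normc (x i 0).
Proof.
have s0 : 0 <= \sum_i normc (x i 0) by rewrite sumr_ge0// => i _; rewrite normc_ge0.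
rewrite -[leRHS]ger0_norm// -sqrtr_sqr ler_wsqrtr//.
rewrite expr2 mulr_suml ler_sum // => i _; rewrite expr2 ler_wpM2l ?normc_ge0 //.
by rewrite (bigD1 i) //= lerDl sumr_ge0// => k _; rewrite normc_ge0.
Qed.

Lemma vnorm2_delta N (j : 'I_N) : vnorm2 (delta_mx j 0 : 'cV[R[i]]_N) = 1.
Proof.
rewrite /vnorm2 (bigD1 j) //= mxE !eqxx Normc.normc1 expr1n big1 ?addr0 ?sqrtr1//.
by move=> i /negPf ij; rewrite mxE ij Normc.normc0 expr0n.
Qed.

(** Coordinates of a unit vector have modulus at most 1. This also makes the set behind [specnorm]
    bounded above, which the entrywise lower bound needs. *)
Lemma vnorm2_mulmx N (B : 'M[R[i]]_N) (x : 'cV[R[i]]_N) : vnorm2 x = 1 ->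
  vnorm2 (B *m x) <= \sum_i \sum_j normc (B i j).
Proof.
move=> x1; apply: (le_trans (vnorm2_le_sum _)); apply: ler_sum => i _.
rewrite mxE; apply: (le_trans (normc_sum _)); apply: ler_sum => j _.
by rewrite Normc.normcM ler_piMr ?normc_ge0 // -x1 normc_le_vnorm2.
Qed.

Lemma normc_le_specnorm N (B : 'M[R[i]]_N) i j : normc (B i j) <= specnorm B.
Proof.
have -> : B i j = (B *m delta_mx j 0 : 'cV_N) i 0 by rewrite -colE mxE.
apply: (le_trans (normc_le_vnorm2 _ _)); apply: ub_le_sup.
  exists (\sum_i \sum_j normc (B i j)) => _ [x x1 <-]; exact: vnorm2_mulmx.
by exists (delta_mx j 0) => //; exact: vnorm2_delta.
Qed.

Lemma specnorm_le_sum N (B : 'M[R[i]]_N) : (0 < N)%N ->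
  specnorm B <= \sum_i \sum_j normc (B i j).
Proof.
move=> N0; apply: ge_sup => [|_ [x x1 <-]]; last exact: vnorm2_mulmx.
have j : 'I_N := Ordinal N0.
by exists (vnorm2 (B *m delta_mx j 0)), (delta_mx j 0) => //; exact: vnorm2_delta.
Qed.

(** Isolates the single dominant entry; [b] summed over all N^2 entries is the error term. *)
Lemma specnorm_le_peak N (B : 'M[R[i]]_N) (i0 j0 : 'I_N) (a b : R) :
  (forall i j, normc (B i j) <= a *+ ((i == i0) && (j == j0)) + b) ->
  specnorm B <= a + b * (N ^ 2)%:R.
Proof.
move=> le_B; apply: le_trans (specnorm_le_sum _ _) _.
  exact: leq_ltn_trans (leq0n i0) (ltn_ord i0).
have -> : a + b * (N ^ 2)%:R =
    \sum_i \sum_j (a *+ ((i == i0) && (j == j0)) + b).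
  under eq_bigr do rewrite big_split /= sumr_const card_ord.
  rewrite big_split /= sumr_const card_ord -mulrnA mulr_natr mulnn; congr (_ + _).
  rewrite (bigD1 i0) //= (bigD1 j0) //= !eqxx /= !big1 ?addr0 //.
    by move=> i /negPf ->; rewrite big1.
  by move=> j /negPf ->.
by apply: ler_sum => i _; apply: ler_sum => j _.
Qed.

End Norms.

(** * The family *)

Section Family.
Variables (R : realType) (q N : nat) (g : R).
Local Notation C := R[i].

(** The default of [insubd] is never reached once [2 * q + 1 <= N]. *)
Definition flip (i : 'I_N) : 'I_N :=
  if (i <= 2 * q)%N then insubd i (2 * q - i)%N else i.

Definition Jhat : 'M[C]_N := \matrix_(i, j) (j == flip i)%:R.

(** A concrete choice of positive, pairwise distinct values, below 1 at every index past the shift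
    block. *)
Definition tail_eig (i : nat) : R := i.+1%:R^-1.

Definition Ahat : 'M[C]_N := \matrix_(i, j)
  (if (i <= 2 * q)%N then g *+ (i == j.+1 :> nat)
   else tail_eig i *+ (i == j))%:C.

Hypothesis hN : (2 * q + 1 <= N)%N.

Lemma flipE i : flip i = (if i <= 2 * q then 2 * q - i else i)%N :> nat.
Proof.
rewrite /flip; case: leqP => // iq; rewrite insubdK // unfold_in /=; lia.
Qed.

Lemma flipK : involutive flip.
Proof.
move=> i; apply: val_inj; rewrite /= !flipE; case: (leqP i) => iq; last first.
  by rewrite ifF //; lia.
by rewrite leq_subr; lia.
Qed.

Lemma mul_Jhat (B : 'M[C]_N) i j : (Jhat *m B) i j = B (flip i) j.
Proof.
rewrite mxE (bigD1 (flip i)) //= mxE eqxx mul1r big1 ?addr0 // => k /negPf ki.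
by rewrite mxE ki mul0r.
Qed.

Lemma mulmx_Jhat (B : 'M[C]_N) i j : (B *m Jhat) i j = B i (flip j).
Proof.
rewrite mxE (bigD1 (flip j)) //= mxE flipK eqxx mulr1 big1 ?addr0 // => k kj.
by rewrite mxE -(can_eq flipK) flipK eq_sym (negPf kj) mulr0.
Qed.

Lemma Jhat_sqr : Jhat *m Jhat = 1%:M.
Proof.
apply/matrixP => i j; rewrite mul_Jhat !mxE flipK.
by rewrite eq_sym.
Qed.

Lemma Jhat_fundamental : fundamental_symmetry Jhat.
Proof.
have [Ju _] := mulmx1_unit Jhat_sqr; split=> //.
  apply/matrixP => i j; rewrite !mxE rmorph_nat -(can_eq flipK) flipK.
  by rewrite eq_sym.
by rewrite -[RHS]mulmx1 -Jhat_sqr mulKmx.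
Qed.

(** All entries are real, and the shift is symmetric about the antidiagonal of its block: 2q - j = i
    + 1 and 2q - i = j + 1 both say i + j + 1 = 2q. On the tail A is diagonal and J is the
    identity. *)
Lemma Jhat_selfadjoint : J_selfadjoint Jhat Ahat.
Proof.
apply/matrixP => i j; rewrite mul_Jhat mulmx_Jhat /adjmx !mxE.
rewrite [LHS]conjc_real; congr (_%:C).
rewrite -!val_eqE /= !flipE; case: (leqP j) => jq; case: (leqP i) => iq.
- by rewrite !leq_subr; congr (_ *+ nat_of_bool _); lia.
- rewrite leq_subr [(i <= 2 * q)%N]leqNgt iq /=.
  have -> : (2 * q - j == i.+1)%N = false by lia.
  by have -> : (i == j :> nat) = false by lia.
- rewrite leq_subr [(j <= 2 * q)%N]leqNgt jq /=.
  have -> : (j == i :> nat) = false by lia.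
  by have -> : (2 * q - i == j.+1)%N = false by lia.
- rewrite [(j <= 2 * q)%N]leqNgt jq [(i <= 2 * q)%N]leqNgt iq /= eq_sym.
  by case: eqVneq => [->|].
Qed.

End Family.

(** * Negative index of [Jhat] *)

Lemma char_poly_similar (F : fieldType) n (P A B : 'M[F]_n) :
  P \in unitmx -> A *m P = P *m B -> char_poly A = char_poly B.
Proof.
rewrite unitmxE unitfE => P0 AP.
have: char_poly_mx A *m map_mx polyC P = map_mx polyC P *m char_poly_mx B.
  by rewrite mulmxBl mulmxBr -!map_mxM AP scalar_mxC.
move/(congr1 determinant); rewrite !det_mulmx mulrC => /mulfI; apply.
by rewrite det_map_mx polyC_eq0.
Qed.

(** Both sides equal J + D, so J and D are similar as soon as 1 + J D is invertible. *)
Lemma involution_intertwine (F : fieldType) n (J D : 'M[F]_n) :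
  J *m J = 1%:M -> D *m D = 1%:M ->
  J *m (1%:M + J *m D) = (1%:M + J *m D) *m D.
Proof.
move=> JJ DD; rewrite mulmxDr mulmxDl mulmx1 mul1mx mulmxA JJ mul1mx.
by rewrite -mulmxA DD mulmx1 addrC.
Qed.

Section JhatIndex.
Variables (R : realType) (q N : nat).
Hypothesis hN : (2 * q + 1 <= N)%N.
Local Notation C := R[i].

(** Of each pair {i, 2q - i} swapped by [flip] exactly one index gets -1; the centre q and the tail
    get +1. *)
Let d (i : 'I_N) : C := (-1) ^+ (i < q)%N.
Let D : 'M[C]_N := diag_mx (\row_i d i).
Let J : 'M[C]_N := Jhat R q N.

Let DD : D *m D = 1%:M.
Proof.
apply/matrixP => i j; rewrite mul_diag_mx !mxE mulrnAr -signr_addb addbb expr0.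
by case: eqP.
Qed.

Let d_flip (i : 'I_N) : flip q i != i -> d i + d (flip q i) = 0.
Proof.
rewrite -val_eqE /= /d flipE //; case: (leqP i (2 * q)) => [iq qi|_ /eqP//].
have -> : (2 * q - i < q)%N = ~~ (i < q)%N by apply/idP/idP; lia.
by case: (i < q)%N; rewrite /= ?expr0 ?expr1 ?subrr ?addNr.
Qed.

(* The columns of 1 + J D are eigenvectors of J: e_i - e_(flip i) for i < q,
   e_i + e_(flip i) for the other i. *)
Lemma Jhat_eigenbasis_unit : 1%:M + J *m D \in unitmx.
Proof.
pose e (i : 'I_N) : C := 2%:R * (1 + (flip q i == i)%:R).
have e0 i : e i != 0 by rewrite mulf_neq0 // ?pnatr_eq0 // -natr1E -natrD pnatr_eq0.
(* The product is 2 + D J + J D: opposite signs on a swapped pair cancel off the diagonal, and a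
   fixed index, whose sign is +1, gives 4. *)
suff QP : (1%:M + D *m J) *m (1%:M + J *m D) = diag_mx (\row_i e i).
  have: diag_mx (\row_i e i) \in unitmx.
    rewrite unitmxE unitfE det_diag; apply/prodf_neq0 => i _; by rewrite mxE.
  by rewrite -QP unitmx_mul => /andP[].
rewrite mulmxDl !mulmxDr !mul1mx mulmx1 mulmxA -(mulmxA D) Jhat_sqr // mulmx1 DD.
apply/matrixP => i j; rewrite mul_mx_diag mul_diag_mx !mxE.
have [<-{j}|ij] := eqVneq i j.
  rewrite /e eq_sym; case: eqVneq => fi; rewrite ?mulr0 ?mul0r ?mulr1n /=; last by ring.
  suff -> : d i = 1 by rewrite /=; ring.
  rewrite /d ltnNge; suff -> : (q <= i)%N by [].
  by move/(congr1 val): fi; rewrite /= flipE //; case: (leqP i (2 * q)) => iq; lia.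
rewrite !mulr0n; case: eqVneq => [ji|]; last by rewrite mulr0 mul0r !addr0.
by rewrite mulr1 mul1r ji addr0 add0r addrC d_flip // -ji eq_sym.
Qed.

Lemma Jhat_neg_index : neg_index J = q.
Proof.
rewrite /neg_index (char_poly_similar (B := D) Jhat_eigenbasis_unit); last first.
  exact: involution_intertwine (Jhat_sqr _ hN) DD.
rewrite char_poly_trig ?diag_mx_is_trig //.
under eq_bigr do rewrite !mxE eqxx mulr1n.
rewrite -(big_map d xpredT (fun x => 'X - x%:P)) mu_prod_XsubC count_map.
rewrite (eq_count (a2 := preim val (fun k => k < q)%N)); last first.
  move=> i /=; rewrite /d; case: (i < q)%N; first by rewrite expr1 eqxx.
  by rewrite expr0 -subr_eq0 opprK (pnatr_eq0 C 2).
rewrite -count_map /index_enum -enumT val_enum_ord -size_filter.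
rewrite (_ : [seq k <- _ | _] = iota 0 q) ?size_iota //.
have -> : N = (q + (N - q))%N by lia.
rewrite iotaD filter_cat (@eq_in_filter _ _ xpredT) ?filter_predT.
  rewrite (@eq_in_filter _ _ pred0) ?filter_pred0 ?cats0 // => k.
  by rewrite mem_iota /=; lia.
by move=> k; rewrite mem_iota /=; lia.
Qed.

End JhatIndex.

(** * Powers and spectrum of [Ahat] *)

Section AhatSpectrum.
Variables (R : realType) (q N : nat) (g : R).
Local Notation C := R[i].
Local Notation A := (Ahat q N g).

Lemma tail_eig_gt0 i : 0 < tail_eig R i.
Proof. by rewrite invr_gt0 ltr0Sn. Qed.

Lemma tail_eig_lt1 i : (2 * q < i)%N -> tail_eig R i < 1.
Proof. by move=> qi; rewrite invf_lt1 ?ltr0Sn // ltr1n ltnS; lia. Qed.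

Lemma tail_eig_inj : injective (tail_eig R).
Proof. by move=> i j /invr_inj/eqP; rewrite eqr_nat eqSS => /eqP. Qed.

Hypothesis hN : (2 * q + 1 <= N)%N.

(** This and the next two row rules serve both the powers of A and the check of the resolvent
    formula. *)
Lemma mul_Ahat_first (B : 'M[C]_N) (i j : 'I_N) :
  i = 0 :> nat -> (A *m B) i j = 0.
Proof. by move=> i0; rewrite mxE big1 // => k _; rewrite mxE i0 mul0r. Qed.

Lemma mul_Ahat_shift (B : 'M[C]_N) (i i' j : 'I_N) :
  i = i'.+1 :> nat -> (i <= 2 * q)%N -> (A *m B) i j = g%:C * B i' j.
Proof.
move=> ii' iq; rewrite mxE (bigD1 i') //= mxE iq ii' eqxx mulr1n.
rewrite big1 ?addr0 // => k ki'; rewrite mxE iq ii' eqSS eq_sym.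
by rewrite -val_eqE in ki'; rewrite (negPf ki') mulr0n mul0r.
Qed.

Lemma mul_Ahat_tail (B : 'M[C]_N) (i j : 'I_N) :
  (2 * q < i)%N -> (A *m B) i j = (tail_eig R i)%:C * B i j.
Proof.
rewrite ltnNge => /negPf iq; rewrite mxE (bigD1 i) //= mxE iq eqxx mulr1n.
rewrite big1 ?addr0 // => k /negPf ki; by rewrite mxE iq eq_sym ki mulr0n mul0r.
Qed.

Lemma AhatX k i j : (A ^+ k) i j =
  (if (i <= 2 * q)%N then g ^+ k *+ (i == j + k :> nat)%N
   else tail_eig R i ^+ k *+ (i == j))%:C.
Proof.
elim: k i j => [|k IHk] i j.
  by rewrite expr0 mxE addn0 !expr0 -val_eqE; case: ifP; case: eqP.
rewrite exprS -[A * _]/(A *m _); case: leqP => iq; last first.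
  by rewrite mul_Ahat_tail // IHk leqNgt iq /= -rmorphM exprS mulrnAr.
case: (posnP i) => i0.
  by rewrite mul_Ahat_first // i0 addnS mulr0n.
have i'N : (i.-1 < N)%N by have := ltn_ord i; lia.
rewrite (@mul_Ahat_shift _ _ (Ordinal i'N)) ?prednK // IHk /=.
rewrite ifT; last by lia.
rewrite -rmorphM mulrnAr exprS; congr (_ *+ nat_of_bool _)%:C; lia.
Qed.

(** A is lower triangular, so its eigenvalues are its diagonal entries: 0 on the shift block,
    however large g is, and the tail values. *)
Lemma Ahat_spectrum : spectrum A `<=` [set z | normc z < 1].
Proof.
move=> z; rewrite /spectrum /= eigenvalue_root_char char_poly_trig; last first.
  apply/is_trig_mxP => i j ij; rewrite mxE.
  have -> : (i == j.+1 :> nat) = false by lia.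
  by have -> : (i == j) = false; [rewrite -val_eqE /=; lia|case: ifP].
rewrite -(big_map (fun i => A i i) xpredT (fun x => 'X - x%:P)) root_prod_XsubC.
move/mapP => [i _ ->]; rewrite mxE eqxx; case: leqP => iq.
  by rewrite ltn_eqF // mulr0n Normc.normc0 ltr01.
by rewrite mulr1n normc_real ?ltW ?tail_eig_gt0 ?tail_eig_lt1.
Qed.

End AhatSpectrum.

(** * Degree of the minimal polynomial *)

Lemma horner_mx_coef (F : comNzRingType) n (B : 'M[F]_n.+1) (p : {poly F}) i j :
  horner_mx B p i j = \sum_(k < size p) p`_k * (B ^+ k) i j.
Proof.
rewrite -[in LHS](coefK p) poly_def rmorph_sum summxE; apply: eq_bigr => k _.
by rewrite /= horner_mxZ rmorphXn /= horner_mx_X mxE.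
Qed.

(** Cayley-Hamilton gives the upper bound; for the lower one the hypothesis is applied to the
    minimal polynomial. Annihilation is spelled out entrywise so as to make sense for size 0 too. *)
Lemma minpoly_degree_full (R : realType) n (B : 'M[R[i]]_n) :
  (forall p : {poly R[i]}, p != 0 ->
     (forall i j, \sum_(k < size p) p`_k * (B ^+ k) i j = 0) -> (n < size p)%N) ->
  minpoly_degree B = n.
Proof.
case: n B => [|n] B lb //; apply/eqP; rewrite eqn_leq; apply/andP; split.
  suff: (size (mxminpoly B) <= n.+2)%N by rewrite /minpoly_degree; case: size.
  by rewrite -(size_char_poly B) dvdp_leq ?mxminpoly_dvd_char // monic_neq0 // char_poly_monic.
rewrite ltn_predRL lb //.
  by rewrite monic_neq0 // mxminpoly_monic.
by move=> i j; rewrite -horner_mx_coef mx_root_minpoly mxE.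
Qed.

Section AhatMinpoly.
Variables (R : realType) (q N : nat) (g : R).
Hypothesis hN : (2 * q + 1 <= N)%N.
Hypothesis g0 : g != 0.
Local Notation C := R[i].

(* The first column of p(A) shows that 'X^(2q+1) divides p, its diagonal that the
   N - (2q+1) nonzero eigenvalues are roots of p. *)
Lemma annihilator_Ahat_size (p : {poly C}) : p != 0 ->
  (forall i j : 'I_N, \sum_(k < size p) p`_k * (Ahat q N g ^+ k) i j = 0) ->
  (N < size p)%N.
Proof.
move=> p0 pA.
(* Entry (k, 0) of p(A) is p_k g^k. *)
have coef_low k : (k <= 2 * q)%N -> p`_k = 0.
  move=> kq; have kN : (k < N)%N by lia.
  have zN : (0 < N)%N by lia.
  have := pA (Ordinal kN) (Ordinal zN).
  under eq_bigr do rewrite AhatX //= kq add0n.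
  have [kp|pk _] := ltnP k (size p); last by rewrite nth_default.
  rewrite (bigD1 (Ordinal kp)) //= eqxx mulr1n big1 ?addr0 => [/eqP|l].
    rewrite mulf_eq0 => /orP[/eqP//|/eqP gk].
    have /eqP : g ^+ k = 0 by apply: complexI.
    by rewrite expf_eq0 (negPf g0) andbF.
  by rewrite -val_eqE eq_sym /= => /negPf ->; rewrite mulr0n mulr0.
have pE : p = drop_poly (2 * q + 1) p * 'X^(2 * q + 1).
  rewrite -[LHS](poly_take_drop (2 * q + 1)) -[RHS]add0r; congr (_ + _).
  apply/polyP => k; rewrite coef_take_poly coef0.
  by case: ltnP => // kq; rewrite coef_low //; lia.
set r := drop_poly (2 * q + 1) p in pE.
have r0 : r != 0 by apply: contraNneq p0 => r0; rewrite pE r0 mul0r.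
have rE : size r = (size p - (2 * q + 1))%N by rewrite size_drop_poly.
pose s := [seq (tail_eig R k)%:C | k <- iota (2 * q + 1) (N - (2 * q + 1))].
(* The N - (2q+1) distinct roots of [r] and the factor X^(2q+1) force degree at least N. *)
suff : (size s < size r)%N by rewrite size_map size_iota rE; lia.
apply: max_poly_roots => //; last first.
  rewrite map_inj_uniq ?iota_uniq // => k l /complexI; exact: tail_eig_inj.
apply/allP => _ /mapP[k + ->]; rewrite mem_iota => /andP[qk kN].
have {}kN : (k < N)%N by lia.
(* Entry (k, k) of p(A) is p at the k-th tail value; this value is nonzero, hence a root of the
   cofactor [r]. *)
have := pA (Ordinal kN) (Ordinal kN).
have kq : (k <= 2 * q)%N = false by lia.
under eq_bigr do rewrite AhatX //= kq eqxx mulr1n rmorphXn /=.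
rewrite -horner_coef [in X in X -> _]pE hornerM hornerXn => /eqP.
rewrite mulf_eq0 expf_eq0 => /orP[//|/andP[_ /eqP/complexI tk0]].
by have := tail_eig_gt0 R k; rewrite tk0 ltxx.
Qed.

Lemma Ahat_minpoly_degree : minpoly_degree (Ahat q N g) = N.
Proof. exact/minpoly_degree_full/annihilator_Ahat_size. Qed.

Lemma nu_hat : nu (Jhat R q N) (Ahat q N g) = (2 * q + 1)%N.
Proof. by rewrite /nu Jhat_neg_index // Ahat_minpoly_degree; lia. Qed.

End AhatMinpoly.

(** * Power bound and Kreiss constant *)

Section KreissPeak.
Variable R : realType.

Lemma bernoulli_ineq (s : R) n : 0 <= s -> 1 + (s - 1) *+ n <= s ^+ n.
Proof.
move=> s0; elim: n => [|n IHn]; first by rewrite mulr0n addr0 expr0.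
rewrite exprS mulrSr; apply: le_trans (ler_wpM2l s0 IHn).
(* The two sides differ by n (s - 1)^2. *)
rewrite -(mulr_natr (s - 1)); have := sqr_ge0 (s - 1); have := ler0n R n; nra.
Qed.

(** For m > 0, the maximum of (t - 1) / t^(m+1) over t > 1, attained at t = (m+1)/m. *)
Definition kreiss_peak (m : nat) : R := m%:R ^+ m / m.+1%:R ^+ m.+1.

Lemma kreiss_peak_gt0 m : (0 < m)%N -> 0 < kreiss_peak m.
Proof. by move=> m0; rewrite divr_gt0 // exprn_gt0 ?ltr0n. Qed.

Lemma kreiss_peak_max m (t : R) : 1 < t ->
  (t - 1) / t ^+ m.+1 <= kreiss_peak m.
Proof.
move=> t1; have t0 : 0 < t by lra.
rewrite ler_pdivrMr ?exprn_gt0 // /kreiss_peak mulrAC ler_pdivlMr ?exprn_gt0 ?ltr0n //.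
have [->|m0] := posnP m; first by rewrite expr0 !expr1; lra.
have mR : 0 < m%:R :> R by rewrite ltr0n.
(* Bernoulli's inequality at this point, which is 1 exactly at the maximiser, replaces calculus. *)
have s0 : 0 <= t * m%:R / m.+1%:R by rewrite divr_ge0 ?mulr_ge0 ?(ltW t0).
have := bernoulli_ineq m.+1 s0.
have -> : 1 + (t * m%:R / m.+1%:R - 1) *+ m.+1 = (t - 1) * m%:R.
  rewrite -mulr_natr -natr1; field; lra.
rewrite !exprMn exprVn ler_pdivlMr ?exprn_gt0 ?ltr0n // => le_t.
rewrite -(ler_pM2r mR) [leLHS]mulrAC; apply: le_trans le_t _.
by rewrite [m%:R ^+ m.+1]exprSr mulrA ler_pM2r // mulrC.
Qed.

Lemma kreiss_peak_attained m (t := m.+1%:R / m%:R : R) : (0 < m)%N ->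
  (t - 1) / t ^+ m.+1 = kreiss_peak m.
Proof.
move=> m0; have mR : m%:R != 0 :> R by rewrite pnatr_eq0 -lt0n.
rewrite /t /kreiss_peak expr_div_n invf_div mulrA; congr (_ / _).
by rewrite -natr1 exprSr; field.
Qed.

(** The middle term is e (m/(m+1))^m; both bounds come from 1 + x <= exp x, at x = 1/m for the lower
    and x = -1/(m+1) for the upper one. *)
Lemma kreiss_peak_exp m : (0 < m)%N ->
  1 <= expR 1 * m.+1%:R * kreiss_peak m <= expR (m.+1%:R^-1 : R).
Proof.
move=> m0; have mR : 0 < m%:R :> R by rewrite ltr0n.
have nR : 0 < m.+1%:R :> R by rewrite ltr0n.
have -> : expR 1 * m.+1%:R * kreiss_peak m = expR 1 * (m%:R / m.+1%:R) ^+ m.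
  rewrite /kreiss_peak expr_div_n exprS; field.
  by rewrite expf_neq0 gt_eqF.
apply/andP; split.
  rewrite -[m%:R / _]invf_div exprVn ler_pdivlMr ?exprn_gt0 ?divr_gt0 // mul1r.
  have -> : expR 1 = expR (m%:R^-1) ^+ m :> R.
    by rewrite -expRM_natl mulfV ?gt_eqF.
  rewrite lerXn2r ?nnegrE ?expR_ge0 ?divr_ge0 //.
  apply: le_trans _ (expR_ge1Dx _); rewrite -natr1 mulrDl mulfV ?gt_eqF //.
  by rewrite mul1r.
have -> : expR (m.+1%:R^-1) = expR 1 * expR (- m.+1%:R^-1) ^+ m :> R.
  rewrite -expRM_natl -expRD; congr expR; rewrite -natr1; field; lra.
rewrite ler_wpM2l ?expR_ge0 // lerXn2r ?nnegrE ?expR_ge0 ?divr_ge0 //.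
apply: le_trans _ (expR_ge1Dx _).
have -> // : m%:R / m.+1%:R = 1 + - m.+1%:R^-1 :> R.
by rewrite -natr1; field; lra.
Qed.

End KreissPeak.

(** * Two-sided bounds for M(A) and K(A) *)

Section AhatConstants.
Variables (R : realType) (q N : nat) (g : R).
Hypothesis q0 : (0 < q)%N.
Hypothesis hN : (2 * q + 1 <= N)%N.
Hypothesis g1 : 1 <= g.
Local Notation C := R[i].
Local Notation A := (Ahat q N g).

Let g0 : 0 <= g := le_trans ler01 g1.

Let last_lt : (2 * q < N)%N.
Proof. by rewrite -addn1. Qed.
Let first_lt : (0 < N)%N := leq_ltn_trans (leq0n _) last_lt.
Let lastI := Ordinal last_lt.
Let firstI := Ordinal first_lt.

(** Truncated subtraction is safe because q > 0: above the diagonal it gives 0, never 2q. *)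
Let band_index (i j : 'I_N) : (i <= 2 * q)%N ->
  (i == lastI) && (j == firstI) = (i - j == 2 * q)%N.
Proof. by move=> iq; rewrite -!val_eqE /=; lia. Qed.

Let gX_low k : (k <= 2 * q)%N -> (k == 2 * q)%N = false -> g ^+ k <= g ^+ (2 * q).-1.
Proof. by move=> kq kN; rewrite ler_weXn2l //; lia. Qed.

Let gX_ge1 k : 1 <= g ^+ k.
Proof. exact: exprn_ege1. Qed.

(** The corner entry of A^(2q) gives the lower bound. In every power, each entry off the corner is
    at most g^(2q-1): within the block it is 0 or g^k with k < 2q, on the tail at most 1. *)
Lemma Ahat_power_bound : exists M : R, power_bound A = M%:E /\
  g ^+ (2 * q) <= M <= g ^+ (2 * q) + g ^+ (2 * q).-1 * (N ^ 2)%:R.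
Proof.
have lb : ((g ^+ (2 * q))%:E <= power_bound A)%E.
  apply: (@le_trans _ _ (specnorm (A ^+ (2 * q)))%:E); last first.
    by apply: ereal_sup_ubound; exists (2 * q)%N.
  rewrite lee_fin; apply: le_trans _ (normc_le_specnorm _ lastI firstI).
  by rewrite AhatX //= leqnn add0n eqxx mulr1n normc_real // exprn_ge0.
have ub : (power_bound A <= (g ^+ (2 * q) + g ^+ (2 * q).-1 * (N ^ 2)%:R)%:E)%E.
  apply: ge_ereal_sup => _ [k _ <-]; rewrite lee_fin.
  apply: (specnorm_le_peak (i0 := lastI) (j0 := firstI)) => i j.
  have gX k' : 0 <= g ^+ k' by rewrite exprn_ge0.
  rewrite AhatX //; case: ifPn => iq; last first.
    rewrite -ltnNge in iq; have t0 := ltW (tail_eig_gt0 R i).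
    rewrite normc_real ?mulrn_wge0 ?exprn_ge0 //.
    rewrite ler_wpDl ?mulrn_wge0 //; apply: le_trans (gX_ge1 _).
    case: (i == j); last by rewrite mulr0n.
    by rewrite mulr1n exprn_ile1 // ltW // (tail_eig_lt1 _ iq).
  rewrite normc_real ?mulrn_wge0 // band_index //.
  case: eqP => [ijk|_]; last by rewrite mulr0n addr_ge0 ?mulrn_wge0.
  have -> : (i - j)%N = k by lia.
  rewrite mulr1n; case: eqP => [->|/eqP kq]; first by rewrite mulr1n lerDl.
  by rewrite mulr0n add0r gX_low //; [lia|exact: negbTE].
move: lb ub; case: (power_bound A) => [M| |] //; rewrite !lee_fin => lb ub.
by exists M; split=> //; rewrite lb ub.
Qed.

(** The Neumann series of A^k / z^(k+1), summed in closed form; on the nilpotent block each entry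
    has at most one term. *)
Definition resolvent_hat (z : C) : 'M[C]_N := \matrix_(i, j)
  if (i <= 2 * q)%N then (if (j <= i)%N then g%:C ^+ (i - j) / z ^+ (i - j).+1 else 0)
  else (i == j)%:R / (z - (tail_eig R i)%:C).

Let dist_tail (z : C) (i : 'I_N) : 1 < normc z -> (2 * q < i)%N ->
  normc z - 1 <= normc (z - (tail_eig R i)%:C).
Proof.
move=> z1 iq; have := normc_le_add (z - (tail_eig R i)%:C) (tail_eig R i)%:C.
rewrite subrK [normc (tail_eig _ _)%:C]normc_real ?(ltW (tail_eig_gt0 _ _)) //.
rewrite lerBlDr => /le_trans; apply.
by rewrite lerD2l ltW // (@tail_eig_lt1 R q).
Qed.

Lemma invmx_resolvent (z : C) : 1 < normc z ->
  invmx (z%:M - A) = resolvent_hat z.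
Proof.
move=> z1; have z0 : z != 0.
  by apply: contraTneq z1 => ->; rewrite Normc.normc0 ltr10.
suff AR : (z%:M - A) *m resolvent_hat z = 1%:M.
  have [Au _] := mulmx1_unit AR.
  by rewrite -[LHS]mulmx1 -AR mulKmx.
apply/matrixP => i j; rewrite mulmxBl mul_scalar_mx !mxE.
set S := (X in _ - X); have -> : S = (A *m resolvent_hat z) i j by rewrite mxE.
case: leqP => iq; last first.
  rewrite mul_Ahat_tail // mxE leqNgt iq /= -mulrBl.
  rewrite mulrCA divff ?mulr1 //; apply/eqP => zl.
  by have := dist_tail z1 iq; rewrite zl Normc.normc0 subr_le0 leNgt z1.
have [i0|i0] := posnP i.
  rewrite mul_Ahat_first // subr0 -val_eqE /= i0 leqn0.
  case: (posnP j) => [->|j0]; first by rewrite subnn expr0 expr1 mul1r divff.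
  by rewrite mulr0 -(negbK (0 == _)) eq_sym -lt0n j0.
have i'N : (i.-1 < N)%N by have := ltn_ord i; lia.
rewrite (@mul_Ahat_shift _ _ _ _ _ _ (Ordinal i'N)) ?prednK // mxE /=.
have -> : (i.-1 <= 2 * q)%N by lia.
case: (ltngtP j i) => [ji|ji|/val_inj ->].
- have -> : (j <= i.-1)%N by lia.
  have -> : (i - j)%N = (i.-1 - j).+1 by lia.
  rewrite -val_eqE /= gtn_eqF // mulr0n; set k := (i.-1 - j)%N.
  rewrite (exprS g%:C) (exprS z k.+1).
  have : z ^+ k.+1 != 0 by rewrite expf_neq0.
  move: (z ^+ k.+1) (g%:C ^+ k) (g%:C) => w x y w0.
  by field; rewrite w0 z0.
- have -> : (j <= i.-1)%N = false by lia.
  by rewrite !mulr0 subr0 -val_eqE /= ltn_eqF.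
- have -> : (i <= i.-1)%N = false by lia.
  by rewrite mulr0 subr0 subnn expr0 expr1 mul1r divff // eqxx.
Qed.

(** The corner entry of the resolvent is g^(2q) / z^(2q+1), whose weighted maximum is [kreiss_peak].
    The other block entries, times |z| - 1, are at most g^(2q-1) since (|z| - 1) / |z|^(k+1) <= 1,
    and the tail ones at most 1. *)
Lemma Ahat_kreiss_constant : exists K : R, kreiss_constant A = K%:E /\
  g ^+ (2 * q) * kreiss_peak R (2 * q) <= K <=
  g ^+ (2 * q) * kreiss_peak R (2 * q) + g ^+ (2 * q).-1 * (N ^ 2)%:R.
Proof.
have qR : 0 < (2 * q)%:R :> R by rewrite ltr0n; lia.
have gC k : normc (g%:C ^+ k) = g ^+ k by rewrite normcX normc_real.
have lb : ((g ^+ (2 * q) * kreiss_peak R (2 * q))%:E <= kreiss_constant A)%E.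
  (* The maximiser of (t - 1) / t^(2q+1), used as a real point z. *)
  pose t : R := (2 * q).+1%:R / (2 * q)%:R.
  have t1 : 1 < t by rewrite ltr_pdivlMr // mul1r ltr_nat.
  have t0 : 0 <= t by lra.
  apply: (@le_trans _ _ ((normc t%:C - 1) * specnorm (invmx (t%:C%:M - A)))%:E).
    rewrite lee_fin normc_real // invmx_resolvent ?normc_real //.
    rewrite -kreiss_peak_attained -/t; last by lia.
    rewrite mulrCA ler_wpM2l ?subr_ge0 ?(ltW t1) //.
    apply: le_trans _ (normc_le_specnorm _ lastI firstI).
    by rewrite mxE /= leqnn subn0 Normc.normcM Normc.normcV gC normcX normc_real.
  by apply: ereal_sup_ubound; exists t%:C => //=; rewrite normc_real.
have ub : (kreiss_constant A <=
    (g ^+ (2 * q) * kreiss_peak R (2 * q) + g ^+ (2 * q).-1 * (N ^ 2)%:R)%:E)%E.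
  apply: ge_ereal_sup => _ [z z1 <-]; rewrite lee_fin invmx_resolvent //.
  rewrite /= in z1; have tp : 0 < normc z - 1 by rewrite subr_gt0.
  set a := _ * kreiss_peak _ _; set b := g ^+ _.-1.
  have a0 : 0 <= a by rewrite mulr_ge0 ?exprn_ge0 // ltW // kreiss_peak_gt0; lia.
  have b0 : 0 <= b by rewrite exprn_ge0.
  (* The weight |z| - 1 moves to the right-hand side, so that the peak bound applies to the
     resolvent itself. *)
  rewrite mulrC -ler_pdivlMr // mulrDl -(mulrAC b).
  apply: (specnorm_le_peak (i0 := lastI) (j0 := firstI)) => i j.
  rewrite -mulrnAl -mulrDl ler_pdivlMr // mxE.
  case: leqP => iq; last first.
    rewrite ler_wpDl ?mulrn_wge0 //; apply: le_trans (gX_ge1 _).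
    rewrite Normc.normcM Normc.normcV normc_nat mulrAC.
    have dz := dist_tail z1 iq; rewrite ler_pdivrMr ?(lt_le_trans tp) // mul1r.
    apply: le_trans dz; rewrite ler_piMl ?(ltW tp) //.
    by rewrite lern1 leq_b1.
  case: leqP => ji; last by rewrite Normc.normc0 mul0r addr_ge0 ?mulrn_wge0.
  rewrite band_index // Normc.normcM Normc.normcV gC normcX mulrAC -mulrA mulrCA.
  set k := (i - j)%N; have kq : (k <= 2 * q)%N by lia.
  have gk : 0 <= g ^+ k by rewrite exprn_ge0.
  case: eqP => [kE|/eqP/negbTE kN].
    rewrite mulr1n kE ler_wpDr // /a -mulrCA ler_wpM2l ?exprn_ge0 //.
    exact: kreiss_peak_max.
  rewrite mulr0n add0r; apply: le_trans (gX_low kq kN).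
  rewrite mulrCA ler_piMr // ler_pdivrMr ?exprn_gt0 ?(lt_trans ltr01) // mul1r.
  apply: (@le_trans _ _ (normc z)); first by rewrite lerBlDr lerDl.
  by rewrite exprS ler_peMr ?exprn_ege1 ?(ltW z1) // (le_trans ler01) ?(ltW z1).
move: lb ub; case: (kreiss_constant A) => [K| |] //; rewrite !lee_fin => lb ub.
by exists K; split=> //; rewrite lb ub.
Qed.

End AhatConstants.

(** * The limit *)

Section Ratio.
Variable R : realType.

(** With G = g^(2q) and n = 2q+1, M lies between G and G (1 + 1/n), and e n K between G and G
    (exp(1/n) + e/n); these are the resulting bounds on the quotient. *)
Definition ratio_lower (n : nat) : R := (expR n%:R^-1 + expR 1 * n%:R^-1)^-1.
Definition ratio_upper (n : nat) : R := 1 + n%:R^-1.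

Lemma cvg_inv_index : ((2 * q + 1)%:R^-1 : R) @[q --> \oo] --> (0 : R).
Proof.
apply: (@squeeze_cvgr _ _ _ _ (fun=> 0) harmonic); last 2 first.
- exact: cvg_cst.
- exact: cvg_harmonic.
apply: nearW => q; rewrite invr_ge0 ler0n /= lef_pV2 ?posrE ?ltr0n ?addn1 //.
by rewrite ler_nat; lia.
Qed.

Lemma cvg_ratio_upper : ratio_upper (2 * q + 1) @[q --> \oo] --> (1 : R).
Proof.
rewrite -[X in _ --> X]addr0; apply: cvgD; [exact: cvg_cst|exact: cvg_inv_index].
Qed.

Lemma cvg_ratio_lower : ratio_lower (2 * q + 1) @[q --> \oo] --> (1 : R).
Proof.
rewrite -[X in _ --> X]invr1; apply: cvgV; first exact: oner_neq0.
have h1 : (expR (2 * q + 1)%:R^-1 : R) @[q --> \oo] --> (expR 0 : R).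
  apply: (@cvg_comp _ _ _ (fun q => (2 * q + 1)%:R^-1 : R) expR _ (nbhs (0 : R))).
    exact: cvg_inv_index.
  exact: continuous_expR.
have h2 : (expR 1 * (2 * q + 1)%:R^-1 : R) @[q --> \oo] --> (expR 1 * 0 : R).
  exact: cvgM (cvg_cst _) cvg_inv_index.
have := cvgD h1 h2; rewrite expR0 mulr0 addr0. exact.
Qed.

(** The bounds depend on q alone, so they squeeze the quotient along any admissible N(q). *)
Lemma ratio_bounds q N (A := Ahat q N ((N ^ 4)%:R : R)) :
  (0 < q)%N -> (2 * q + 1 <= N)%N ->
  ((ratio_lower (2 * q + 1))%:E <=
   power_bound A / ((expR 1 * (2 * q + 1)%:R)%:E * kreiss_constant A) <=
   (ratio_upper (2 * q + 1))%:E)%E.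
Proof.
move=> q0 hN; have NR : 0 < N%:R :> R by rewrite ltr0n; lia.
have g1 : 1 <= (N ^ 4)%:R :> R by rewrite ler1n expn_gt0; lia.
have [M [ME /andP[leM Mle]]] := Ahat_power_bound q0 hN g1.
have [K [KE /andP[leK Kle]]] := Ahat_kreiss_constant q0 hN g1.
have := @kreiss_peak_exp R (2 * q); have := @kreiss_peak_gt0 R (2 * q).
rewrite muln_gt0 q0 => /(_ isT) c0 /(_ isT).
rewrite {}/A ME KE -addn1.
move: leM Mle leK Kle c0; set c := kreiss_peak _ _; set n := (2 * q + 1)%N.
set G := (N ^ 4)%:R ^+ (2 * q).
have n0 : 0 < n%:R :> R by rewrite ltr0n /n; lia.
have G0 : 0 < G by rewrite exprn_gt0 // (lt_le_trans ltr01).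
(* The choice g = N^4 pays here: the N^2 error entries together cost only G / N^2. *)
have -> : (N ^ 4)%:R ^+ (2 * q).-1 * (N ^ 2)%:R = G / (N ^ 2)%:R :> R.
  rewrite /G -[in RHS](@prednK (2 * q)); last by lia.
  rewrite exprS !natrX; field; lra.
set e := expR 1; have e0 : 0 < e by exact: expR_gt0.
(* N >= n makes the error uniform in N. *)
have dN : (N ^ 2)%:R^-1 <= n%:R^-1 / n%:R :> R.
  rewrite -invfM lef_pV2 ?posrE ?mulr_gt0 // ?natrX ?exprn_gt0 //.
  by rewrite expr2 ler_pM ?ler0n // ler_nat.
have d0 : 0 <= (N ^ 2)%:R^-1 :> R by rewrite invr_ge0.
have n1 : n%:R^-1 / n%:R <= n%:R^-1 :> R.
  by rewrite ler_pdivrMr // ler_peMr ?invr_ge0 ?ler0n // ler1n /n; lia.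
move=> leM Mle leK Kle c0 /andP[c1 c2].
have K0 : 0 < K by apply: lt_le_trans leK; rewrite mulr_gt0.
have enK : 0 < e * n%:R * K by rewrite !mulr_gt0.
(* The denominator is a positive real, so the extended inverse is the real one. *)
rewrite -EFinM inver gt_eqF // -EFinM !lee_fin; apply/andP; split.
  rewrite ler_pdivlMr // mulrC ler_pdivrMr; last first.
    by rewrite addr_gt0 ?expR_gt0 // mulr_gt0 // invr_gt0.
  apply: (@le_trans _ _ (G * (e * n%:R * c + e * n%:R * (N ^ 2)%:R^-1))).
    by rewrite -mulrDr mulrCA ler_wpM2l ?mulr_ge0 ?(ltW e0) ?(ltW n0) // mulrDr.
  apply: ler_pM => //; first exact: ltW.
    by rewrite addr_ge0 // ?mulr_ge0 // ltW.
  rewrite lerD // -mulrA ler_wpM2l ?(ltW e0) //.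
  by rewrite mulrC -ler_pdivlMr.
rewrite ler_pdivrMr //; apply: (le_trans Mle).
apply: (@le_trans _ _ (ratio_upper n * G)).
  by rewrite mulrDl mul1r lerD2l mulrC ler_wpM2r ?(ltW G0) // (le_trans dN).
rewrite ler_wpM2l //; first by rewrite addr_ge0 // invr_ge0.
apply: (@le_trans _ _ (e * n%:R * (G * c))).
  by rewrite mulrCA ler_peMr ?(ltW G0).
by rewrite ler_wpM2l ?mulr_ge0 ?(ltW e0) ?(ltW n0).
Qed.

Lemma cvg_ratio (N : nat -> nat) (A := fun q N => Ahat q N ((N ^ 4)%:R : R)) :
  (forall q, (1 <= q)%N -> (2 * q + 1 <= N q)%N) ->
  (power_bound (A q (N q)) /
     ((expR 1 * (2 * q + 1)%:R)%:E * kreiss_constant (A q (N q))))%E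
    @[q --> \oo] --> 1%E.
Proof.
move=> hN; apply: (@squeeze_cvge _ _ _ _
  (fun q => (ratio_lower (2 * q + 1))%:E) _ (fun q => (ratio_upper (2 * q + 1))%:E)).
- by near=> q; apply: ratio_bounds; [|apply: hN]; near: q; exists 1%N.
- by apply: cvg_EFin; [exact: nearW|exact: cvg_ratio_lower].
- by apply: cvg_EFin; [exact: nearW|exact: cvg_ratio_upper].
Unshelve. all: by end_near. Qed.

End Ratio.

Theorem corollary5p3 (R : realType) :
  exists J A : forall q N : nat, 'M[R[i]]_N,
  [/\ forall q N : nat, (1 <= q)%N -> (2 * q + 1 <= N)%N ->
        [/\ fundamental_symmetry (J q N) /\ neg_index (J q N) = q,
            J_selfadjoint (J q N) (A q N),
            spectrum (A q N) `<=` [set z : R[i] | Normc.normc z < 1],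
            minpoly_degree (A q N) = N &
            nu (J q N) (A q N) = (2 * q + 1)%N],
      forall N : nat -> nat, (forall q, (1 <= q)%N -> (2 * q + 1 <= N q)%N) ->
        (power_bound (A q (N q)) /
           ((expR 1 * (2 * q + 1)%:R)%:E * kreiss_constant (A q (N q))))%E
          @[q --> \oo] --> 1%E &
      exists N : nat -> nat,
        [/\ forall q, (1 <= q)%N -> (2 * q + 1 <= N q)%N,
            (q%:R / (N q)%:R : R) @[q --> \oo] --> (0 : R) &
            (power_bound (A q (N q)) /
               ((expR 1 * (2 * q + 1)%:R)%:E * kreiss_constant (A q (N q))))%E
              @[q --> \oo] --> 1%E]].
Proof.
exists (fun q N => Jhat R q N), (fun q N => Ahat q N ((N ^ 4)%:R : R)); split.
- move=> q N q0 hN; have g0 : (N ^ 4)%:R != 0 :> R.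
    by rewrite pnatr_eq0 -lt0n expn_gt0; lia.
  split; [split|..].
  + exact: Jhat_fundamental.
  + exact: Jhat_neg_index.
  + exact: Jhat_selfadjoint.
  + exact: Ahat_spectrum.
  + exact: Ahat_minpoly_degree.
  + exact: nu_hat.
- by move=> N hN; exact: cvg_ratio.
(* With this choice q / N(q) <= 1 / (2q+1). *)
exists (fun q => (2 * q + 1) ^ 2)%N.
have hN q : (1 <= q)%N -> (2 * q + 1 <= (2 * q + 1) ^ 2)%N.
  by move=> _; rewrite expnS expn1 leq_pmulr // addn1.
split=> //; last exact: cvg_ratio.
apply: (@squeeze_cvgr _ _ _ _ (fun=> 0) (fun q => (2 * q + 1)%:R^-1)); last 2 first.
- exact: cvg_cst.
- exact: cvg_inv_index.
apply: nearW => q; rewrite divr_ge0 //= natrX expr2 invfM mulrA.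
rewrite ler_piMl ?invr_ge0 ?ler0n // ler_pdivrMr ?ltr0n ?addn1 // mul1r ler_nat.
lia.
Qed.
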